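(* Let $\Omega\subseteq\mathbb{R}^N$ be open and bounded, $\sigma(x):=\mathrm{dist}(x,\partial\Omega)$, and let $\eta\in C^\infty(\Omega)$ be such that there exists $\kappa>0$ with $\kappa\sigma(x)^2\le\eta(x)\le\sigma(x)^2$ for every $x\in\Omega$. Let $\rho$, $M_\rho$, $C_n$, $T_n$ be as in the context. Then $$\sup_{n\in\mathbb{N}}\ \sup_{y\in\Omega}\int_\Omega C_n(x)\rho\Big(\frac{x-y}{\frac1n\eta(x)}\Big)\,dx<\infty,$$ and hence $T=T_1$ and $T_n$, $n\in\mathbb{N}$, are bounded linear operators from $L^1(\Omega)$ to $L^1(\Omega)$.
   Context: $\rho\in C_c^\infty(\mathbb{R}^N)$ satisfies $0\le\rho\le1$, $\rho(x)=0$ iff $|x|\ge1$, $\rho$ is radially symmetric, and $\rho(x)\ge\rho(1/2)$ for all $|x|<1/2$. Set $M_\rho:=(\int_{B_1(0)}\rho(y)\,dy)^{-1}$. For $x\in\Omega$ and $n\in\mathbb{N}$ let $C_n(x):=M_\rho n^N/\eta(x)^N$, and for $f\in L^1_{loc}(\Omega)$ let $T_nf(x):=C_n(x)\int_\Omega\rho\big(\frac{x-y}{\frac1n\eta(x)}\big)f(y)\,dy$; $T:=T_1$. *)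

(* Defs.v *)
(* MathComp-Analysis on an abstract R : realType.
   R^N is modelled as N.-tuple R, which MathComp-Analysis equips with the
   product (Borel) sigma-algebra generated by the coordinate projections. *)
From mathcomp Require Import all_boot all_order all_algebra.
From mathcomp Require Import all_classical all_reals all_analysis.
Set Implicit Arguments. Unset Strict Implicit. Unset Printing Implicit Defensive.
Import Order.TTheory GRing.Theory Num.Theory.
Local Open Scope classical_set_scope.
Local Open Scope ring_scope.

Section Rn.
Variables (R : realType) (N : nat).
Notation V := (N.-tuple R).

Definition vadd (x y : V) : V := [tuple tnth x i + tnth y i | i < N].
Definition vsub (x y : V) : V := [tuple tnth x i - tnth y i | i < N].
Definition vscale (a : R) (x : V) : V := [tuple a * tnth x i | i < N].
Definition ebasis (i : 'I_N) : V := [tuple (j == i)%:R | j < N].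

Definition enorm (x : V) : R := Num.sqrt (\sum_(i < N) tnth x i ^+ 2).

Definition eopen (O : set V) : Prop :=
  forall x, O x -> exists2 r : R, 0 < r & forall z, enorm (vsub z x) < r -> O z.

Definition ebounded (O : set V) : Prop :=
  exists M : R, forall x, O x -> enorm x <= M.

Definition boundary (O : set V) : set V :=
  [set z | forall e : R, 0 < e ->
     (exists a, O a /\ enorm (vsub z a) < e) /\
     (exists b, ~ O b /\ enorm (vsub z b) < e)].

Definition dist_bd (O : set V) (x : V) : R :=
  inf [set enorm (vsub x z) | z in boundary O].

Definition cont_on (O : set V) (f : V -> R) : Prop :=
  forall x, O x -> forall e : R, 0 < e -> exists2 d : R, 0 < d &
    forall z, O z -> enorm (vsub z x) < d -> `|f z - f x| < e.

Definition pderiv (i : 'I_N) (f : V -> R) (x : V) : R :=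
  derive1 (fun t : R => f (vadd x (vscale t (ebasis i)))) 0.

Definition pderivable_on (O : set V) (i : 'I_N) (f : V -> R) : Prop :=
  forall x, O x -> derivable (fun t : R => f (vadd x (vscale t (ebasis i)))) 0 1.

Fixpoint Ck_on (O : set V) (k : nat) (f : V -> R) : Prop :=
  cont_on O f /\
  match k with
  | 0 => True
  | k'.+1 => forall i : 'I_N, pderivable_on O i f /\ Ck_on O k' (pderiv i f)
  end.

Definition smooth_on (O : set V) (f : V -> R) : Prop := forall k, Ck_on O k f.

Definition box (a b : V) : set V :=
  [set x | forall i : 'I_N, tnth a i <= tnth x i <= tnth b i].

(* mu is the Lebesgue measure on (the Borel sets of) R^N: it gives
   every box its volume; this determines mu uniquely. *)
Definition is_lebesgue (mu : {measure set V -> \bar R}) : Prop :=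
  forall a b : V, (forall i, tnth a i <= tnth b i) ->
    mu (box a b) = (\prod_(i < N) (tnth b i - tnth a i))%:E.

Definition unit_ball : set V := [set x | enorm x < 1].

(* the hypotheses on rho: smooth with compact support (support = closed unit
   ball, which is compact), 0 <= rho <= 1, rho x = 0 iff |x| >= 1, radially
   symmetric, and rho(x) >= rho(1/2) for |x| < 1/2, where rho(1/2) is the
   (radial) value of rho on the sphere of radius 1/2. *)
Definition mollifier (rho : V -> R) : Prop :=
  smooth_on setT rho /\
  (forall x, 0 <= rho x <= 1) /\
  (forall x, rho x = 0 <-> 1 <= enorm x) /\
  (forall x y, enorm x = enorm y -> rho x = rho y) /\
  (forall x z, enorm z = 2^-1 -> enorm x < 2^-1 -> rho z <= rho x).

Section Ops.
Variable mu : {measure set V -> \bar R}.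
Variables (rho : V -> R) (eta : V -> R) (Omega : set V).

Definition M_rho : R := (Rintegral mu unit_ball rho)^-1.

Definition C_n (n : nat) (x : V) : R := M_rho * n%:R ^+ N / eta x ^+ N.

Definition kern (n : nat) (x y : V) : R :=
  rho (vscale ((n%:R)^-1 * eta x)^-1 (vsub x y)).

Definition T_n (n : nat) (f : V -> R) (x : V) : R :=
  C_n n x * Rintegral mu Omega (fun y => kern n x y * f y).

Definition L1 (f : V -> R) : Prop := mu.-integrable Omega (EFin \o f).

Definition L1norm (f : V -> R) : \bar R := (\int[mu]_(x in Omega) `|f x|%:E)%E.
End Ops.
End Rn.

(* Main.v *)
(* Write [sigma] for the distance to the boundary of [Omega]. If
   [kern n x y != 0] then [|x - y| < sigma x ^ 2 / n]. When [sigma x <= n / 2]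
   this is at most [sigma x / 2], so that [sigma x <= 2 sigma y] and
   [sigma y <= 3/2 sigma x]; hence [C_n x] is of order [(n / sigma y ^ 2) ^ N]
   while such [x] fill a cube around [y] of volume of order
   [(sigma y ^ 2 / n) ^ N]. When [sigma x > n / 2], [C_n x] is at most
   [M_rho (4 / kappa) ^ N], and [Omega] has finite measure. This bounds the
   integrals in [x] uniformly in [n] and [y], and Tonelli's theorem turns the
   bound into one for the operator norm of [T_n] on [L^1]. *)
From HB Require Import structures.
Require Import Defs.
From mathcomp Require Import all_boot all_order all_algebra.
From mathcomp Require Import all_classical all_reals all_analysis.
From mathcomp Require Import measurable_realfun ring lra.
Import Order.TTheory GRing.Theory Num.Theory.
Local Open Scope classical_set_scope.
Local Open Scope ring_scope.

(** * Euclidean norm and distance to the boundary *)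

Section EuclideanGeometry.
Context {R : realType} {N : nat}.
Implicit Types (x y z : N.-tuple R) (O : set (N.-tuple R)).

Lemma tnth_vsub x y i : tnth (vsub x y) i = tnth x i - tnth y i.
Proof. by rewrite tnth_mktuple. Qed.

Lemma tnth_vadd x y i : tnth (vadd x y) i = tnth x i + tnth y i.
Proof. by rewrite tnth_mktuple. Qed.

Lemma tnth_vscale a x i : tnth (vscale a x) i = a * tnth x i.
Proof. by rewrite tnth_mktuple. Qed.

Lemma sum_sqr_ge0 (a : 'I_N -> R) : 0 <= \sum_i a i ^+ 2.
Proof. by apply: sumr_ge0 => i _; exact: sqr_ge0. Qed.

Lemma enorm_ge0 x : 0 <= enorm x.
Proof. exact: sqrtr_ge0. Qed.

Lemma sqr_enorm x : enorm x ^+ 2 = \sum_(i < N) tnth x i ^+ 2.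
Proof. by rewrite sqr_sqrtr// sum_sqr_ge0. Qed.

Lemma ler_tnth_enorm x i : `|tnth x i| <= enorm x.
Proof.
rewrite -sqrtr_sqr; apply: ler_wsqrtr; rewrite (bigD1 i)//= lerDl.
by apply: sumr_ge0 => j _; exact: sqr_ge0.
Qed.

Lemma enorm_le_natr x (r : R) :
  (forall i, `|tnth x i| <= r) -> enorm x <= N%:R * r.
Proof.
(* For [N = 0] no coordinate forces [0 <= r], but then both sides vanish. *)
case: (posnP N) => [N0 _|N0 h].
  rewrite /enorm big1 ?sqrtr0 ?N0 ?mul0r// => i _.
  by have := ltn_ord i; rewrite {2}N0.
have r0 : 0 <= r by apply: le_trans (h (Ordinal N0)).
rewrite -(@ler_pXn2r _ 2%N)// ?nnegrE ?enorm_ge0// ?mulr_ge0//.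
rewrite sqr_enorm (@le_trans _ _ (\sum_(i < N) r ^+ 2))//.
  by apply: ler_sum => i _; rewrite -real_normK ?num_real// ler_pXn2r ?nnegrE.
rewrite sumr_const card_ord -[leLHS]mulr_natl exprMn ler_wpM2r ?sqr_ge0//.
by rewrite -natrX ler_nat leq_pmulr.
Qed.

Lemma cauchy_schwarz_sum (a b : 'I_N -> R) :
  (\sum_i a i * b i) ^+ 2 <= (\sum_i a i ^+ 2) * (\sum_i b i ^+ 2).
Proof.
set S := \sum_i a i * b i; set A := \sum_i a i ^+ 2; set B := \sum_i b i ^+ 2.
(* If [A = 0], every [a i] vanishes and so does [S]; otherwise a factor [A] can be cancelled. *)
have := sum_sqr_ge0 a; rewrite -/A le0r => /orP[/eqP A0|A0].
  have /allP a0 : all [pred i | a i ^+ 2 == 0] (index_enum 'I_N).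
    have /eqP : A = 0 by [].
    rewrite psumr_eq0//; first by move=> i _; exact: sqr_ge0.
  rewrite /S big1 ?expr0n ?A0 ?mul0r// => i _.
  have := a0 i (mem_index_enum i).
  by rewrite /= sqrf_eq0 => /eqP ->; rewrite mul0r.
(* [A * (A * B - S ^+ 2)] is the sum of the [(A * b i - S * a i) ^+ 2]. *)
have : 0 <= A * (A * B - S ^+ 2).
  have := sum_sqr_ge0 (fun i => A * b i - S * a i).
  congr (_ <= _).
  transitivity (\sum_i (A ^+ 2 * b i ^+ 2 + (- 2 * A * S * (a i * b i)
                         + S ^+ 2 * a i ^+ 2))).
    by apply: eq_bigr => i _; ring.
  by rewrite !big_split/= -!mulr_sumr -/A -/B -/S; ring.
by rewrite pmulr_rge0// subr_ge0.
Qed.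

Lemma enorm_vadd x y : enorm (vadd x y) <= enorm x + enorm y.
Proof.
rewrite -(@ler_pXn2r _ 2%N)// ?nnegrE ?addr_ge0 ?enorm_ge0//.
rewrite sqrrD !sqr_enorm.
under eq_bigr do rewrite tnth_vadd sqrrD.
rewrite !big_split/= lerD2r lerD2l -mulr2n lerMn2r/=.
rewrite (le_trans (ler_norm _))// -(@ler_pXn2r _ 2%N)//.
- rewrite exprMn !sqr_enorm real_normK ?num_real//.
  exact: cauchy_schwarz_sum.
- by rewrite nnegrE mulr_ge0 ?enorm_ge0.
Qed.

Lemma enorm_vsubC x y : enorm (vsub x y) = enorm (vsub y x).
Proof.
by congr Num.sqrt; apply: eq_bigr => i _; rewrite !tnth_vsub -sqrrN opprB.
Qed.

Lemma enorm_triangle x y z :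
  enorm (vsub x z) <= enorm (vsub x y) + enorm (vsub y z).
Proof.
suff -> : vsub x z = vadd (vsub x y) (vsub y z) by exact: enorm_vadd.
by apply: eq_from_tnth => i; rewrite tnth_vadd !tnth_vsub addrA subrK.
Qed.

Lemma enorm_vscale a x : enorm (vscale a x) = `|a| * enorm x.
Proof.
rewrite /enorm -sqrtr_sqr -sqrtrM ?sqr_ge0// mulr_sumr.
by congr Num.sqrt; apply: eq_bigr => i _; rewrite tnth_vscale exprMn.
Qed.

Lemma has_inf_dist O x : boundary O !=set0 ->
  has_inf [set enorm (vsub x z) | z in boundary O].
Proof.
move=> [z Oz]; split; first by exists (enorm (vsub x z)), z.
by exists 0 => _ [w _ <-]; exact: enorm_ge0.
Qed.

(** One half of the 1-Lipschitz continuity of the distance: apply the triangle inequality to each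
    boundary point, then pass to the infimum. *)
Lemma dist_bd_le O x y : boundary O !=set0 ->
  dist_bd O x <= enorm (vsub x y) + dist_bd O y.
Proof.
move=> O0; rewrite addrC -lerBlDr; apply: lb_le_inf.
  by have [] := has_inf_dist O y O0.
move=> _ [z Oz <-]; rewrite lerBlDr addrC.
apply: le_trans (enorm_triangle x y z).
by apply: ge_inf; [have [] := has_inf_dist O x O0|exists z].
Qed.

(** A ball around [x] inside [O] contains no boundary point, because points outside [O] lie
    arbitrarily close to a boundary point. The boundary must be nonempty, since [inf set0] is 0. *)
Lemma dist_bd_gt0 O x : eopen O -> O x -> boundary O !=set0 -> 0 < dist_bd O x.
Proof.
move=> oO Ox O0; have [r r0 hr] := oO _ Ox.
apply: (@lt_le_trans _ _ r) => //; apply: lb_le_inf.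
  by have [] := has_inf_dist O x O0.
move=> _ [z Oz <-]; rewrite leNgt; apply/negP => xz.
have e0 : 0 < r - enorm (vsub x z) by rewrite subr_gt0.
have [_ [b [nOb zb]]] := Oz _ e0.
apply/nOb/hr; rewrite enorm_vsubC.
by have := enorm_triangle x z b; lra.
Qed.

(** Move from [x] along a coordinate axis, with unit speed. The times spent in [O] form a bounded
    set, and at their supremum the line meets the boundary: members of [O] lie just before, and no
    later point of the line is in [O]. *)
Lemma boundary_neq0 O x : (0 < N)%N -> ebounded O -> O x -> boundary O !=set0.
Proof.
move=> N0 [M OM] Ox; pose e := ebasis R (Ordinal N0).
have e1 : enorm e = 1.
  rewrite /enorm (bigD1 (Ordinal N0))//= tnth_mktuple eqxx expr1n.
  rewrite big1 ?addr0 ?sqrtr1//.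
  by move=> i /negbTE; rewrite tnth_mktuple eq_sym => ->; rewrite expr0n.
pose p t := vadd x (vscale t e).
have pB s t : enorm (vsub (p s) (p t)) = `|s - t|.
  suff -> : vsub (p s) (p t) = vscale (s - t) e by rewrite enorm_vscale e1 mulr1.
  apply: eq_from_tnth => i; rewrite tnth_vsub !tnth_vadd !tnth_vscale; ring.
pose S : set R := [set t | O (p t)].
have p0 : p 0 = x.
  by apply: eq_from_tnth => i; rewrite tnth_vadd tnth_vscale mul0r addr0.
have supS : has_sup S.
  split; first by exists 0; rewrite /S/= p0.
  exists (M + enorm x) => t /OM pM; rewrite (le_trans (ler_norm _))//.
  have -> : `|t| = enorm (vsub (p t) (p 0)) by rewrite pB subr0.
  (* [vscale 0 x] plays the origin, so that the triangle inequality for differences bounds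
     [p t - p 0] by the two norms. *)
  have z0 (u w : N.-tuple R) : vsub u (vscale 0 w) = u.
    by apply: eq_from_tnth => i; rewrite tnth_vsub tnth_vscale mul0r subr0.
  apply: (le_trans (enorm_triangle _ (vscale 0 x) _)).
  by rewrite z0 p0 lerD// enorm_vsubC z0.
exists (p (sup S)) => d d0; split.
  have [t St dt] := sup_adherent d0 supS.
  exists (p t); split => //; rewrite pB ger0_norm ?subr_ge0; first lra.
  exact: (ub_le_sup supS.2).
exists (p (sup S + d / 2)); split; last first.
  by rewrite pB opprD addrA subrr sub0r normrN ger0_norm; lra.
move=> /(ub_le_sup supS.2); lra.
Qed.

End EuclideanGeometry.

(** * Borel sets of R^N and Lebesgue measure *)

Section BorelMeasurability.
Context {R : realType} {N : nat}.
Implicit Types (x y z a b : N.-tuple R) (O : set (N.-tuple R)).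

Lemma measurable_box a b : measurable (box a b).
Proof.
rewrite (_ : box a b = \bigcap_(i in [set: 'I_N])
    ((fun x => tnth x i) @^-1` `[tnth a i, tnth b i])); last first.
  apply/seteqP; split => x /= h i; first by move=> _; rewrite /= in_itv/= h.
  by have := h i I; rewrite /= in_itv.
apply: fin_bigcap_measurable => [|i _]; first exact: finite_finset.
rewrite -[X in measurable X]setTI; exact: measurable_tnth.
Qed.

(** The sigma-algebra is generated by the coordinates, so openness enters through boxes: an open set
    is the countable union of the boxes with rational corners that it contains. *)
Lemma eopen_measurable O : eopen O -> measurable O.
Proof.
move=> oO.
pose rbox (ab : N.-tuple rat * N.-tuple rat) : set (N.-tuple R) :=
  box [tuple ratr (tnth ab.1 i) | i < N] [tuple ratr (tnth ab.2 i) | i < N].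
pose F ab := if `[< rbox ab `<=` O >] then rbox ab else set0.
suff -> : O = \bigcup_ab F ab.
  apply: countable_bigcupT_measurable; first exact: countableP.
  by move=> ab; rewrite /F; case: ifP => // _; exact: measurable_box.
apply/seteqP; split=> [x Ox|x [ab _]]; last first.
  by rewrite /F; case: asboolP => // h /h.
have [r r0 hr] := oO _ Ox.
(* With [N.+1] as divisor, [N%:R * e < r] is strict, also for [N = 0]. *)
pose e := r / N.+1%:R.
have e0 : 0 < e by rewrite divr_gt0.
have /choice[q hq] (i : 'I_N) : exists pq : rat * rat,
    tnth x i - e < ratr pq.1 < tnth x i /\ tnth x i < ratr pq.2 < tnth x i + e.
  have [p] := @rat_in_itvoo R (tnth x i - e) (tnth x i) ltac:(lra).
  rewrite in_itv/= => hp.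
  have [p'] := @rat_in_itvoo R (tnth x i) (tnth x i + e) ltac:(lra).
  by rewrite in_itv/= => hp'; exists (p, p').
exists ([tuple (q i).1 | i < N], [tuple (q i).2 | i < N]) => //.
rewrite /F; case: asboolP => [_ i|[]].
  by rewrite !tnth_mktuple/=; have := hq i; lra.
move=> z hz; apply: hr; apply: (@le_lt_trans _ _ (N%:R * e)).
  apply: enorm_le_natr => i; rewrite tnth_vsub ler_norml.
  by have := hz i; rewrite !tnth_mktuple/=; have := hq i; lra.
by rewrite /e mulrA ltr_pdivrMr// mulrC ltr_pM2l// ltr_nat.
Qed.

Lemma eopenT : eopen [set: N.-tuple R].
Proof. by move=> x _; exists 1. Qed.

(** The half-lines above [c] generate the Borel sets of the reals, and their preimages in the open
    set [O] are open. *)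
Lemma cont_on_measurable O (f : N.-tuple R -> R) :
  eopen O -> cont_on O f -> measurable_fun O f.
Proof.
move=> oO cf mO; apply: (measurability _ (RGenOInfty.measurableE R)) => //.
move=> _ [_ [c ->] <-]; apply: eopen_measurable => x [Ox].
rewrite /= in_itv/= andbT => cfx.
have [r r0 hr] := oO _ Ox.
have [d d0 hd] := cf _ Ox (f x - c) ltac:(by rewrite subr_gt0).
exists (Num.min r d); first by rewrite lt_min r0.
move=> z; rewrite lt_min => /andP[/hr Oz /(hd _ Oz)].
by rewrite ltr_norml => /andP[h _]; split => //=; rewrite in_itv/= andbT; lra.
Qed.

Lemma ebounded_subset_box O : ebounded O ->
  exists2 M : R, 0 <= M & O `<=` box [tuple - M | i < N] [tuple M | i < N].
Proof.
move=> [M OM]; exists `|M| => // x /OM xM i; rewrite !tnth_mktuple -ler_norml.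
exact: le_trans (ler_tnth_enorm _ _) (le_trans xM (ler_norm _)).
Qed.

Context (mu : {measure set (N.-tuple R) -> \bar R}) (hmu : is_lebesgue mu).

Lemma is_lebesgue_cube (c : N.-tuple R) (r : R) : 0 <= r ->
  mu (box [tuple tnth c i - r | i < N] [tuple tnth c i + r | i < N]) =
  ((2 * r) ^+ N)%:E.
Proof.
move=> r0; rewrite hmu => [|i]; last by rewrite !tnth_mktuple; lra.
congr EFin; rewrite (eq_bigr (fun=> 2 * r)) ?prodr_const ?card_ord// => i _.
by rewrite !tnth_mktuple; ring.
Qed.

(** Cubes about the origin exhaust the space. Tonelli's theorem for [mu] rests on this. *)
Lemma is_lebesgue_sigma_finite : sigma_finite setT mu.
Proof.
pose c0 : N.-tuple R := [tuple 0 | i < N].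
exists (fun n : nat =>
  box [tuple tnth c0 i - n%:R | i < N] [tuple tnth c0 i + n%:R | i < N]).
  apply/seteqP; split => // x _; exists (Num.truncn (enorm x)).+1 => // i.
  rewrite !tnth_mktuple sub0r add0r -ler_norml.
  by apply: le_trans (ler_tnth_enorm _ _) (ltW (truncnS_gt _)).
move=> n; split; first exact: measurable_box.
by rewrite is_lebesgue_cube// ltry.
Qed.

Lemma ebounded_lty O : measurable O -> ebounded O -> (mu O < +oo)%E.
Proof.
move=> mO /ebounded_subset_box[M M0 OM].
apply: (@le_lt_trans _ _ (mu (box [tuple - M | i < N] [tuple M | i < N]))).
  by apply: le_measure; rewrite ?inE//; exact: measurable_box.
by rewrite hmu ?ltry// => i; rewrite !tnth_mktuple; lra.
Qed.

End BorelMeasurability.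

(** * Integral operators with a kernel of bounded column integrals *)

(* An alias of [mu], so that HB can attach a sigma-finite structure to it. *)
Definition sigma_finite_copy {d} {T : measurableType d} {R : realType}
  (mu : {measure set T -> \bar R}) of sigma_finite setT mu :
  set T -> \bar R := mu.

Section SigmaFiniteCopy.
Context {d} {T : measurableType d} {R : realType}.
Context (mu : {measure set T -> \bar R}) (mu_sigma : sigma_finite setT mu).

HB.instance Definition _ := Measure.copy (sigma_finite_copy mu mu_sigma) mu.
HB.instance Definition _ :=
  @Measure_isSigmaFinite.Build d T R (sigma_finite_copy mu mu_sigma) mu_sigma.

(** An equality of bundled measures, so that a result proved for sigma-finite measures can be
    rewritten into one about [mu]. *)
Lemma sigma_finite_measure_of :
  exists m : {sigma_finite_measure set T -> \bar R},
    (m : {measure set T -> \bar R}) = mu.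
Proof. by exists (sigma_finite_copy mu mu_sigma); exact: eq_measure. Qed.

End SigmaFiniteCopy.

Section SchurTest.
Context {d} {T : measurableType d} {R : realType}.
Context (mu : {sigma_finite_measure set T -> \bar R}).
Context (D : set T) (mD : measurable D) (k : T -> T -> R) (B : R).
Hypothesis mk : measurable_fun (D `*` D) (fun p => k p.1 p.2).
Hypothesis k0 : forall x y, D x -> D y -> 0 <= k x y.
Hypothesis B0 : 0 <= B.
Hypothesis kB :
  forall y, D y -> (\int[mu]_(x in D) (k x y)%:E <= B%:E)%E.

Let op (f : T -> R) x := Rintegral mu D (fun y => k x y * f y).

(** Extension by zero turns integrals over [D] into integrals over the whole space, where Fubini and
    Tonelli are applied. *)
Let F (f : T -> R) : T * T -> \bar R :=
  (fun p => (k p.1 p.2 * f p.2)%:E) \_ (D `*` D).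

Let FE f x y : D x ->
  F f (x, y) = ((fun y => (k x y * f y)%:E) \_ D) y.
Proof.
move=> Dx; rewrite /F /patch; congr (if _ then _ else _).
by apply/idP/idP; rewrite !inE => // -[].
Qed.

Let F_out f x y : ~ (D x /\ D y) -> F f (x, y) = 0%E.
Proof.
by move=> nD; rewrite /F /patch ifF//; apply/negbTE; rewrite notin_setE.
Qed.

Let measurable_F f : measurable_fun D f -> measurable_fun setT (F f).
Proof.
move=> mf; have mDD : measurable (D `*` D) by exact: measurableX.
refine (iffLR (measurable_restrictT _ mDD) _).
apply/measurable_EFinP; apply: measurable_funM => //.
apply: (measurable_comp mD) => //; first by move=> _ [p [_ ?]] <-.
exact: measurable_funTS.
Qed.

(** Tonelli exchanges the integrals. For [y] in [D] the inner integral is then [|f y|] times a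
    column integral of [k], bounded by [kB]; for other [y] it vanishes. *)
Let integral_F f : measurable_fun D f ->
  (\int[mu]_x \int[mu]_y `|F f (x, y)| <= B%:E * \int[mu]_(x in D) `|f x|%:E)%E.
Proof.
move=> mf; have mF := measurable_F f mf.
have mF' : measurable_fun setT (abse \o F f) by exact: measurableT_comp.
rewrite -(@fubini_tonelli1 _ _ _ _ _ mu mu (abse \o F f))//=.
rewrite fubini_tonelli2//.
rewrite -ge0_integralZl//; last first.
  by apply/measurable_EFinP; exact: measurableT_comp.
rewrite [leRHS]integral_mkcond; apply: ge0_le_integral => //.
- by move=> y _; exact: integral_ge0.
- exact: measurable_fun_fubini_tonelli_G.
- refine (iffLR (measurable_restrictT _ mD) _); apply: measurable_funeM.
  by apply/measurable_EFinP; exact: measurableT_comp.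
move=> y _; rewrite /fubini_G patchE; case: ifPn => [|yD]; last first.
  rewrite integral0_eq// => x _ /=; rewrite F_out ?abse0// => -[_ Dy].
  by move/negP: yD; rewrite inE.
rewrite inE => Dy.
rewrite (_ : (fun x => _) = (fun x => `|f y|%:E * (k x y)%:E)%E \_ D); last first.
  apply/funext => x; rewrite /= patchE; case: ifPn => [|/negP]; rewrite inE => Dx.
    rewrite FE// patchE mem_set//= normrM (ger0_norm (k0 _ _ _ _))//.
    by rewrite mulrC EFinM.
  by rewrite F_out ?abse0// => -[].
rewrite -integral_mkcond ge0_integralZl//=.
- by rewrite muleC lee_wpmul2r//; exact: kB.
- apply/measurable_EFinP.
  apply: (@measurable_comp _ _ _ _ _ _ (D `*` D) (fun p => k p.1 p.2) D
    (fun x => (x, y))) => //.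
  + exact: measurableX.
  + by move=> _ [x Dx <-].
  + exact: measurable_funTS.
- by move=> x Dx; rewrite lee_fin k0.
Qed.

(** Only an inequality, because [Rintegral] replaces an infinite integral by 0, and the section of
    [F f] at a given [x] may fail to be integrable. *)
Let le_op_F f x : measurable_fun D f -> D x ->
  (`|(op f x)%:E| <= `|\int[mu]_y F f (x, y)|)%E.
Proof.
move=> mf Dx; rewrite /op /Rintegral integral_mkcond.
under [in leRHS]eq_integral do rewrite FE//.
by case: (integral _ _ _) => [r| |]//=; rewrite ?normr0 ?leey.
Qed.

Lemma schur_test (f : T -> R) : mu.-integrable D (EFin \o f) ->
  mu.-integrable D (EFin \o op f) /\
  (\int[mu]_(x in D) `|op f x|%:E <= B%:E * \int[mu]_(x in D) `|f x|%:E)%E.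
Proof.
move=> fi; have mf : measurable_fun D f.
  by apply/measurable_EFinP; exact: measurable_int fi.
have mF := measurable_F f mf.
have mF' : measurable_fun setT (abse \o F f) by exact: measurableT_comp.
have Foo : (\int[mu]_x \int[mu]_y `|F f (x, y)| < +oo)%E.
  apply: le_lt_trans (integral_F f mf) _.
  rewrite lte_mul_pinfty// ?lee_fin//.
  by have /integrableP[] := fi.
have iF : (mu \x mu)%E.-integrable setT (F f) by apply/integrable12ltyP.
have iFF := integrable_fubini_F iF.
(* On [D], [op f] is the finite part of the partial integral of [F f], which Fubini makes
   measurable. *)
have mop : measurable_fun D (op f).
  apply: (@eq_measurable_fun _ _ _ _ D (fun x => fine (\int[mu]_y F f (x, y))%E)).
    move=> x; rewrite inE => Dx; rewrite /op /Rintegral [in RHS]integral_mkcond.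
    by congr fine; apply: eq_integral => y _; rewrite FE.
  apply: measurable_funTS; apply: measurableT_comp => //.
  exact: measurable_int iFF.
split.
  apply: le_integrable (integrableS measurableT mD _ iFF) => //.
  - exact/measurable_EFinP.
  - by move=> x Dx; exact: le_op_F.
apply: le_trans (integral_F f mf).
rewrite integral_mkcond; apply: ge0_le_integral => //.
- by move=> x _; rewrite erestrict_ge0// => y _; rewrite lee_fin.
- refine (iffLR (measurable_restrictT _ mD) _).
  by apply/measurable_EFinP; exact: measurableT_comp.
- apply: (measurable_fun_fubini_tonelli_F (abse \o F f)) => // z.
  exact: abse_ge0.
move=> x _; rewrite patchE; case: ifPn => [|_]; last exact: integral_ge0.
rewrite inE => Dx; apply: le_trans (le_op_F f x mf Dx) _.
apply: le_abse_integral => //; exact: (measurableT_comp mF (pair1_measurable x)).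
Qed.

End SchurTest.

(** * The kernel of [T_n] *)

Section Mollification.
Context {R : realType} {N : nat}.
Context (mu : {measure set (N.-tuple R) -> \bar R}) (hmu : is_lebesgue mu).
Context (Omega : set (N.-tuple R)) (eta rho : N.-tuple R -> R) (kappa : R).
Hypotheses (N0 : (0 < N)%N) (oO : eopen Omega) (bO : ebounded Omega).
Hypotheses (eta_cont : cont_on Omega eta) (kappa0 : 0 < kappa).
Hypothesis heta : forall x, Omega x ->
  kappa * dist_bd Omega x ^+ 2 <= eta x <= dist_bd Omega x ^+ 2.
Hypotheses (rho_cont : cont_on setT rho) (rho01 : forall x, 0 <= rho x <= 1).
Hypothesis rho_out : forall x, 1 <= enorm x -> rho x = 0.

Let mOmega : measurable Omega := eopen_measurable _ oO.

Lemma kern01 n x y : 0 <= kern rho eta n x y <= 1.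
Proof. exact: rho01. Qed.

Lemma eta_gt0 x : Omega x -> 0 < eta x.
Proof.
move=> Ox; have /andP[+ _] := heta x Ox; apply: lt_le_trans.
rewrite mulr_gt0// exprn_gt0// dist_bd_gt0//.
exact: boundary_neq0 N0 bO Ox.
Qed.

(** With the convention [0^-1 = 0], inversion preserves nonnegativity whatever the value of the
    integral. *)
Lemma M_rho_ge0 : 0 <= M_rho mu rho.
Proof. by rewrite invr_ge0 Rintegral_ge0// => x _; case/andP: (rho01 x). Qed.

Lemma C_n_ge0 n x : Omega x -> 0 <= C_n mu rho eta n x.
Proof.
move=> Ox; rewrite /C_n !mulr_ge0 ?M_rho_ge0 ?invr_ge0 ?exprn_ge0//.
exact/ltW/eta_gt0.
Qed.

(** The lower bound on [eta] controls the height of the kernel; the upper bound controls its support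
    in [kern_supp]. *)
Lemma C_n_le n x : Omega x ->
  C_n mu rho eta n x <=
  M_rho mu rho * (n%:R / (kappa * dist_bd Omega x ^+ 2)) ^+ N.
Proof.
move=> Ox; have sx := dist_bd_gt0 _ _ oO Ox (boundary_neq0 _ _ N0 bO Ox).
rewrite /C_n -mulrA -expr_div_n ler_wpM2l ?M_rho_ge0//.
have ex := eta_gt0 x Ox; have ks : 0 < kappa * dist_bd Omega x ^+ 2.
  by rewrite mulr_gt0// exprn_gt0.
apply: lerXn2r; rewrite ?nnegrE ?divr_ge0//; [exact: ltW|exact: ltW|].
by rewrite ler_wpM2l// lef_pV2 ?posrE//; case/andP: (heta x Ox).
Qed.

Lemma kern_supp n x y : (0 < n)%N -> Omega x -> kern rho eta n x y != 0 ->
  enorm (vsub x y) < dist_bd Omega x ^+ 2 / n%:R.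
Proof.
move=> n0 Ox; apply: contraNT; rewrite -leNgt => xy; apply/eqP/rho_out.
have ex := eta_gt0 x Ox; have n0' : 0 < n%:R :> R by rewrite ltr0n.
rewrite enorm_vscale ger0_norm ?invr_ge0 ?mulr_ge0 ?invr_ge0//; last exact: ltW.
rewrite ler_pdivlMl ?mulr1 ?mulr_gt0 ?invr_gt0//.
apply: le_trans xy; rewrite mulrC ler_wpM2r ?invr_ge0//.
by case/andP: (heta x Ox).
Qed.

(** The first summand dominates when [dist_bd Omega x <= n / 2], the second otherwise. Both are
    nonnegative, so their sum serves in either case and is easily integrated in [x]. *)
Lemma kernel_le n x y (r := 4 * dist_bd Omega y ^+ 2 / n%:R) :
  (0 < n)%N -> Omega x -> Omega y ->
  C_n mu rho eta n x * kern rho eta n x y <=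
  M_rho mu rho * (9 / kappa / r) ^+ N *
    \1_(box [tuple tnth y i - r | i < N] [tuple tnth y i + r | i < N]) x +
  M_rho mu rho * (4 / kappa) ^+ N.
Proof.
move=> n0 Ox Oy; set Q := box _ _.
have bd := boundary_neq0 _ _ N0 bO Ox.
have s0 := dist_bd_gt0 _ _ oO Ox bd; have t0 := dist_bd_gt0 _ _ oO Oy bd.
have st := dist_bd_le _ x y bd; have ts := dist_bd_le _ y x bd.
have Cs := C_n_le n x Ox; have C0 := C_n_ge0 n x Ox.
have M0 := M_rho_ge0; have supp := kern_supp n x y n0 Ox.
have n1 : 1 <= n%:R :> R by rewrite ler1n.
move: st ts Cs supp; rewrite enorm_vsubC.
have [rho0 rho1] : 0 <= kern rho eta n x y /\ kern rho eta n x y <= 1.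
  by apply/andP; exact: kern01.
set s := dist_bd Omega x in s0 *; set t := dist_bd Omega y in r Q t0 *.
set m : R := n%:R in r Q n1 *; set D := enorm _ => st ts Cs supp.
have m0 : 0 < m by exact: lt_le_trans n1.
have r0 : 0 < r by rewrite /r divr_gt0// mulr_gt0// exprn_gt0.
have c0 : 0 <= 9 / kappa / r.
  by apply: divr_ge0 (ltW r0); apply: divr_ge0 (ltW kappa0).
have a0 : 0 <= M_rho mu rho * (9 / kappa / r) ^+ N * \1_Q x.
  by rewrite indicE mulr_ge0// mulr_ge0// exprn_ge0.
have b0 : 0 <= M_rho mu rho * (4 / kappa) ^+ N.
  by rewrite mulr_ge0// exprn_ge0// divr_ge0// ltW.
have [->|/supp] := eqVneq (kern rho eta n x y) 0; first by rewrite mulr0 addr_ge0.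
move=> Dlt.
have le_C : C_n mu rho eta n x * kern rho eta n x y <= C_n mu rho eta n x.
  by rewrite ler_piMr.
apply: le_trans le_C (le_trans Cs _).
have ks0 : 0 < kappa * s ^+ 2 by rewrite mulr_gt0// exprn_gt0.
have [sm|ms] := leP s (m / 2).
  (* Together with [st] and [ts] this gives [s < 2 * t] and [2 / 3 * t < s]. The former yields
     [D <= r], that is [x] in the cube; the latter yields the factor 9, as [(2 / 3) ^ 2 = 4 / 9]. *)
  have Ds : D < s / 2.
    apply: lt_le_trans Dlt _; rewrite ler_pdivrMr// expr2 -mulrA ler_pM2l//.
    lra.
  have Qx : x \in Q.
    rewrite inE => i; rewrite !tnth_mktuple.
    have := ler_tnth_enorm (vsub x y) i.
    rewrite enorm_vsubC -/D tnth_vsub ler_norml.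
    suff : D <= r by lra.
    apply: le_trans (ltW Dlt) _; rewrite /r ler_wpM2r ?invr_ge0 ?(ltW m0)//.
    rewrite (_ : 4 * t ^+ 2 = (2 * t) ^+ 2); last by ring.
    by apply: lerXn2r; rewrite ?nnegrE; lra.
  rewrite indicE Qx mulr1 -[leLHS]addr0 lerD// ler_wpM2l//.
  apply: lerXn2r => //; first by rewrite nnegrE divr_ge0// ltW.
  rewrite (_ : 9 / kappa / r = m / (kappa * (4 / 9 * t ^+ 2))); last first.
    by rewrite /r; field; rewrite !lt0r_neq0.
  rewrite ler_wpM2l ?(ltW m0)// lef_pV2 ?posrE ?mulr_gt0// ?exprn_gt0//.
  rewrite ler_wpM2l ?(ltW kappa0)//.
  rewrite (_ : 4 / 9 * t ^+ 2 = (2 / 3 * t) ^+ 2); last by field.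
  by apply: lerXn2r; rewrite ?nnegrE; lra.
(* Far from the boundary, [s > m / 2] and [1 <= m] give [m <= m ^ 2 <= 4 * s ^ 2]. *)
rewrite -[leLHS]add0r lerD// ler_wpM2l//.
apply: lerXn2r; rewrite ?nnegrE ?divr_ge0// ?(ltW m0) ?(ltW ks0) ?(ltW kappa0)//.
rewrite ler_pdivrMr// mulrA divfK ?lt0r_neq0//.
suff : (m / 2) ^+ 2 <= s ^+ 2 by nra.
by apply: lerXn2r; rewrite ?nnegrE; lra.
Qed.

Lemma measurable_kernel n : measurable_fun (Omega `*` Omega)
  (fun p => C_n mu rho eta n p.1 * kern rho eta n p.1 p.2).
Proof.
(* The power -1 is a measurable function and agrees with the inverse at the positive values of
   [eta]. Extension by zero makes the argument [g] of [rho] measurable on the whole product. *)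
pose v := (fun x => eta x `^ (-1)) \_ Omega.
have mv : measurable_fun setT v.
  refine (iffLR (measurable_restrictT _ mOmega) _).
  apply: (@measurableT_comp _ _ _ _ _ _ (fun r : R => r `^ (-1))).
    exact: measurable_powR.
  exact: cont_on_measurable.
have vE x : Omega x -> v x = (eta x)^-1.
  by move=> Ox; rewrite /v patchE mem_set// powR_inv1// ltW// eta_gt0.
pose g (p : N.-tuple R * N.-tuple R) := vscale (n%:R * v p.1) (vsub p.1 p.2).
have mg : measurable_fun setT g.
  apply/measurable_fun_tnthP => i.
  rewrite (_ : _ \o g =
    fun p => n%:R * v p.1 * (tnth p.1 i - tnth p.2 i)); last first.
    by apply/funext => p; rewrite /= tnth_vscale tnth_vsub.
  apply: measurable_funM.
    by apply: measurable_funM => //; exact: measurableT_comp.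
  apply: measurable_funB; apply: (measurableT_comp (measurable_tnth i)) => //.
apply: (@eq_measurable_fun _ _ _ _ _
    (fun p => M_rho mu rho * n%:R ^+ N * v p.1 ^+ N * rho (g p))).
  move=> p; rewrite inE => -[Ox Oy].
  by rewrite /C_n /kern /g vE// exprVn invfM invrK.
apply: measurable_funTS; apply: measurable_funM; last first.
  apply: measurableT_comp mg; apply: cont_on_measurable rho_cont; exact: eopenT.
apply: measurable_funM => //; apply: measurable_funX.
exact: measurableT_comp.
Qed.

Lemma measurable_kern n x : measurable_fun setT (kern rho eta n x).
Proof.
apply: (measurableT_comp (cont_on_measurable _ _ eopenT rho_cont)).
apply/measurable_fun_tnthP => i.
rewrite (_ : _ \o _ =
  fun y => (n%:R^-1 * eta x)^-1 * (tnth x i - tnth y i)); last first.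
  by apply/funext => p; rewrite /= tnth_vscale tnth_vsub.
apply: measurable_funM => //; apply: measurable_funB => //.
exact: measurable_tnth.
Qed.

(** The integral of the majorant in [kernel_le]: the cube has side [2 * r] and the first summand has
    height [M_rho * (9 / kappa / r) ^ N], whence 18; the constant summand is integrated over
    [Omega], of finite measure. *)
Definition kernel_bound : R :=
  M_rho mu rho * (18 / kappa) ^+ N +
  M_rho mu rho * (4 / kappa) ^+ N * fine (mu Omega).

Lemma kernel_bound_ge0 : 0 <= kernel_bound.
Proof.
have k0 := ltW kappa0.
rewrite addr_ge0// ?mulr_ge0 ?exprn_ge0 ?divr_ge0 ?M_rho_ge0//.
Qed.

Lemma integral_kernel_le n y : (0 < n)%N -> Omega y ->
  (\int[mu]_(x in Omega) (C_n mu rho eta n x * kern rho eta n x y)%:E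
    <= kernel_bound%:E)%E.
Proof.
move=> n0 Oy; pose r := 4 * dist_bd Omega y ^+ 2 / n%:R.
have bd := boundary_neq0 _ _ N0 bO Oy.
have r0 : 0 < r.
  by rewrite divr_gt0// ?ltr0n// mulr_gt0// exprn_gt0// dist_bd_gt0.
pose Q := box [tuple tnth y i - r | i < N] [tuple tnth y i + r | i < N].
have mQ : measurable Q by exact: measurable_box.
pose a := M_rho mu rho * (9 / kappa / r) ^+ N.
pose b := M_rho mu rho * (4 / kappa) ^+ N.
have a0 : 0 <= a.
  apply: mulr_ge0 M_rho_ge0 _; apply: exprn_ge0; apply: divr_ge0 (ltW r0).
  exact: divr_ge0 (ltW kappa0).
have b0 : 0 <= b.
  by rewrite mulr_ge0 ?M_rho_ge0// exprn_ge0// divr_ge0// ltW.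
have mIQ : measurable_fun Omega (fun x => (\1_Q x)%:E : \bar R).
  by apply/measurable_EFinP; exact: measurable_indic.
apply: (@le_trans _ _ (\int[mu]_(x in Omega) (a%:E * (\1_Q x)%:E + b%:E))%E).
  apply: ge0_le_integral => //.
  - move=> x Ox; rewrite lee_fin mulr_ge0 ?C_n_ge0//.
    by case/andP: (kern01 n x y).
  - apply/measurable_EFinP.
    apply: (@measurable_comp _ _ _ _ _ _ (Omega `*` Omega)
      (fun p => C_n mu rho eta n p.1 * kern rho eta n p.1 p.2) _ (fun x => (x, y))).
    + exact: measurableX.
    + by move=> _ [x Ox <-].
    + exact: measurable_kernel.
    + exact: measurable_funTS.
  - by apply: emeasurable_funD => //; exact: measurable_funeM.
  - by move=> x Ox; rewrite -EFinM -EFinD lee_fin; exact: kernel_le.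
rewrite ge0_integralD//; last 2 first.
  by move=> x _; rewrite -EFinM lee_fin mulr_ge0.
  exact: measurable_funeM.
rewrite ge0_integralZl//.
rewrite integral_indic// integral_cst// /kernel_bound EFinD; apply: leeD.
  apply: (@le_trans _ _ (a%:E * mu Q)%E).
    by apply: lee_wpmul2l; rewrite ?lee_fin// measureIl.
  (* Here [r] cancels, and with it all dependence on [n] and [y]. *)
  rewrite is_lebesgue_cube ?(ltW r0)// -EFinM lee_fin /a -[leLHS]mulrA -exprMn.
  rewrite (_ : 9 / kappa / r * (2 * r) = 18 / kappa)//.
  by field; rewrite !lt0r_neq0.
by rewrite [leRHS]EFinM fineK// ge0_fin_numE// ebounded_lty.
Qed.

(** As [kern] lies between 0 and 1, [|f|] dominates. Hence the integral in [T_n] is finite at every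
    [x], and linearity holds pointwise. *)
Lemma integrable_kern_mul n x f : L1 mu Omega f ->
  mu.-integrable Omega (EFin \o (fun y => kern rho eta n x y * f y)).
Proof.
move=> fi; apply: (@le_integrable _ _ _ mu _ mOmega _ (EFin \o f)) => //.
  apply/measurable_EFinP; apply: measurable_funM.
    by apply: measurable_funTS; exact: measurable_kern.
  by apply/measurable_EFinP; exact: measurable_int fi.
move=> y Oy /=; rewrite lee_fin normrM ler_piMl//.
by rewrite ger0_norm; case/andP: (kern01 n x y).
Qed.

Lemma T_n_linear n f g a x : L1 mu Omega f -> L1 mu Omega g ->
  T_n mu rho eta Omega n (fun y => f y + a * g y) x =
  T_n mu rho eta Omega n f x + a * T_n mu rho eta Omega n g x.
Proof.
move=> fi gi; have kf := integrable_kern_mul n x f fi.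
have kg := integrable_kern_mul n x g gi.
rewrite /T_n; transitivity (C_n mu rho eta n x * Rintegral mu Omega
    (fun y => kern rho eta n x y * f y + a * (kern rho eta n x y * g y))).
  by congr (_ * _); apply: eq_Rintegral => y _; ring.
rewrite RintegralD// ?RintegralZl//; first by ring.
exact: (@integrableZl _ _ _ mu _ mOmega a _ kg).
Qed.

Lemma T_n_bounded n f : (0 < n)%N -> L1 mu Omega f ->
  L1 mu Omega (T_n mu rho eta Omega n f) /\
  (L1norm mu Omega (T_n mu rho eta Omega n f)
    <= kernel_bound%:E * L1norm mu Omega f)%E.
Proof.
move=> n0 fi.
have [m mE] := sigma_finite_measure_of mu (is_lebesgue_sigma_finite mu hmu).
pose k x y := C_n mu rho eta n x * kern rho eta n x y.
(* Moving [C_n] under the integral puts [T_n] in the form of [schur_test]. *)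
have TE : T_n mu rho eta Omega n f =
    fun x => Rintegral mu Omega (fun y => k x y * f y).
  apply/funext => x; rewrite /T_n -RintegralZl//; last exact: integrable_kern_mul.
  by apply: eq_Rintegral => y _; rewrite mulrA.
rewrite /L1norm /L1 TE.
have := @schur_test _ _ _ m Omega mOmega k kernel_bound.
have mE' : m = mu :> (set (N.-tuple R) -> \bar R) by rewrite -mE.
rewrite mE mE'; apply => //.
- exact: measurable_kernel.
- move=> x y Ox Oy; rewrite mulr_ge0 ?C_n_ge0//.
  by case/andP: (kern01 n x y).
- exact: kernel_bound_ge0.
- by move=> y Oy; exact: integral_kernel_le.
Qed.

End Mollification.

Theorem theorem5p3 (R : realType) (N : nat) (hN : (0 < N)%N)
  (mu : {measure set (N.-tuple R) -> \bar R}) (hmu : is_lebesgue mu)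
  (Omega : set (N.-tuple R)) (hOmega_open : eopen Omega)
  (hOmega_bd : ebounded Omega)
  (eta : N.-tuple R -> R) (heta_smooth : smooth_on Omega eta)
  (kappa : R) (hkappa : 0 < kappa)
  (heta : forall x, Omega x ->
     kappa * dist_bd Omega x ^+ 2 <= eta x <= dist_bd Omega x ^+ 2)
  (rho : N.-tuple R -> R) (hrho : mollifier rho) :
  (exists B : R, forall n : nat, (0 < n)%N -> forall y, Omega y ->
     (\int[mu]_(x in Omega) (C_n mu rho eta n x * kern rho eta n x y)%:E
       <= B%:E)%E) /\
  (forall n : nat, (0 < n)%N ->
     (forall (f g : N.-tuple R -> R) (a : R),
        L1 mu Omega f -> L1 mu Omega g -> forall x, Omega x ->
        T_n mu rho eta Omega n (fun y => f y + a * g y) x =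
        T_n mu rho eta Omega n f x + a * T_n mu rho eta Omega n g x) /\
     exists K : R, forall f : N.-tuple R -> R, L1 mu Omega f ->
        L1 mu Omega (T_n mu rho eta Omega n f) /\
        (L1norm mu Omega (T_n mu rho eta Omega n f)
          <= K%:E * L1norm mu Omega f)%E).
Proof.
have [eta_cont _] := heta_smooth 0%N.
have [rho_smooth [rho01 [rho0 _]]] := hrho.
have [rho_cont _] := rho_smooth 0%N.
have rho_out x : 1 <= enorm x -> rho x = 0 by move=> /rho0.
split.
  by exists (kernel_bound mu Omega rho kappa) => n n0 y Oy; exact: integral_kernel_le.
move=> n n0; split=> [f g a fi gi x _|]; first exact: T_n_linear.
(* The same constant bounds the operator norms for all [n]. *)
exists (kernel_bound mu Omega rho kappa) => f fi; exact: T_n_bounded.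
Qed.
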